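(* Let $A\subset\mathbb{N}$ be a random set obtained by picking each element of $\mathbb{N}$ independently with probability $\frac12$. For integers $k\ge 0$ define $$p_k=2^{k/2}\cdot\mathbb{P}(|\mathbb{N}\setminus (A+A)|\ge k).$$ Then the subsequences $\{p_{2k}\}$ and $\{p_{2k+1}\}$ are both increasing and bounded, and therefore convergent. In particular $\mathbb{P}(|\mathbb{N}\setminus (A+A)|\ge k)=\Theta(2^{-k/2})$, and there is a constant $c>0$ such that both limits $\lim_{k\to\infty}p_{2k}$ and $\lim_{k\to\infty}p_{2k+1}$ lie in the interval $[c,c\sqrt2]$.
   Context: $\mathbb{N}=\{1,2,3,\ldots\}$ and $A+A=\{a+b:a,b\in A\}$ (with $a=b$ allowed). ''Increasing'' is meant in the sense $p_{k-2}\le p_k$ for every $k\ge2$. $\Theta$ denotes equality up to positive multiplicative constants from above and below. *)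

(* Defs.v *)
From HB Require Import structures.
From mathcomp Require Import all_boot all_order all_algebra finmap.
From mathcomp Require Import all_classical all_reals all_analysis.

Set Implicit Arguments.
Unset Strict Implicit.
Unset Printing Implicit Defensive.

Import Order.TTheory GRing.Theory Num.Theory.
Import numFieldNormedType.Exports.

Local Open Scope classical_set_scope.
Local Open Scope card_scope.
Local Open Scope ring_scope.

(* Here the natural numbers start at 1, unlike nat. *)
Definition posnat : set nat := [set n | (0 < n)%N].

Definition sumset (A : set nat) : set nat := [set (a + b)%N | a in A & b in A].

Definition missing_sums (A : set nat) : set nat := posnat `\` sumset A.

(* The family of events (E i), i in D, is mutually independent for P: the
   product rule holds over every finite subfamily. *)
Definition mutually_independent (R : realType) (d : measure_display)
    (T : measurableType d) (P : probability T R) (I : choiceType)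
    (D : set I) (E : I -> set T) : Prop :=
  forall J : {fset I}, [set` J] `<=` D ->
    P (\bigcap_(i in [set` J]) E i) = (\prod_(i <- J) P (E i))%E.

Record uniform_random_subset (R : realType) (d : measure_display)
    (T : measurableType d) (P : probability T R) (A : T -> set nat) : Prop := {
  random_subset_posnat : forall w : T, A w `<=` posnat ;
  random_subset_measurable :
    forall n : nat, posnat n -> measurable [set w | A w n] ;
  random_subset_half :
    forall n : nat, posnat n -> P [set w | A w n] = (2^-1 : R)%:E ;
  random_subset_independent :
    mutually_independent P posnat (fun n => [set w | A w n]) }.

(* P(|posnat \ (A + A)| >= k): the comparison `I_k #<= S says that the set S,
   possibly infinite, has at least k elements. *)
Definition prob_missing (R : realType) (d : measure_display)
    (T : measurableType d) (P : probability T R) (A : T -> set nat)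
    (k : nat) : R :=
  fine (P [set w | `I_k #<= missing_sums (A w)]).

Definition scaled_prob (R : realType) (d : measure_display)
    (T : measurableType d) (P : probability T R) (A : T -> set nat)
    (k : nat) : R :=
  2 `^ (k%:R / 2) * prob_missing P A k.

(* Theta for sequences, with constants valid at every index, not only
   eventually. *)
Definition same_order (R : realType) (u v : nat -> R) : Prop :=
  exists c C : R, [/\ 0 < c, 0 < C &
    forall k : nat, c * v k <= u k <= C * v k].

(* Main.v *)
Require Import Defs.
From HB Require Import structures.
From mathcomp Require Import all_boot all_order all_algebra finmap zify lra ring.

(** Shifting [A] by one turns each missing [t] into [t + 2] and creates exactly
    two new missing numbers. Hence P(miss >= k + 2) is half of P(miss >= k) plus
    P(1 in A, miss >= k + 2), which gives the monotonicity, and boundedness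
    follows once P(1 in A, miss >= k) is exponentially smaller than 2^(-k/2).
    That event forces one of three unlikely ones:
    - some t >= 3k is missing, which has probability about (3/4)^(t/2);
    - a small fraction of k missing numbers lies in [17k/16, 3k): if Y is a set
      of such numbers, then [A] is independent in the graph joining x and z when
      x + z is in Y, which is regular on [0, 17k/16), and Sapozhenko's container
      argument gives probability about 2^(-17k/32) up to a small exponential;
    - nearly all of [0, 17k/16) is missing: as 1 is in A, no a in A has a + 1
      missing, so [A] is very sparse there. *)

Set Implicit Arguments.
Unset Strict Implicit.
Unset Printing Implicit Defensive.
Import Order.TTheory GRing.Theory Num.Theory.

(** * Membership of a single element as a free coordinate *)

Section ToggleElement.
Variables (I : finType) (u : I) (Q : pred {set I}).
Hypothesis Q_toggle : forall B : {set I}, Q (u |: B) = Q (B :\ u).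

(** Erasing [u] is a bijection from the sets satisfying [Q] that contain [u] onto those that do
    not. *)
Lemma card_toggle_mem :
  #|[set B : {set I} | Q B & u \in B]| = #|[set B : {set I} | Q B & u \notin B]|.
Proof.
have QE B : Q B = Q (B :\ u).
  by case: (boolP (u \in B)) => uB; [rewrite -Q_toggle (setUidPr _) ?sub1set
    | rewrite (setDidPl _) // disjoint_sym disjoints1].
have <- : [set B :\ u | B in [set B : {set I} | Q B & u \in B]]
   = [set B : {set I} | Q B & u \notin B].
  apply/setP => B; apply/imsetP/idP => [[C]|].
    by rewrite !inE => /andP[QC uC] ->; rewrite -QE QC setD11.
  rewrite inE => /andP[QB uB]; exists (u |: B); last by rewrite setU1K.
  by rewrite inE Q_toggle -QE QB setU11.
rewrite card_in_imset// => B C; rewrite !inE => /andP[_ uB] /andP[_ uC] BC.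
by rewrite -(setD1K uB) BC setD1K.
Qed.

Lemma card_toggle : #|[set B : {set I} | Q B]| = 2 * #|[set B : {set I} | Q B & u \in B]|.
Proof.
rewrite -(cardsID [set B : {set I} | u \in B]) mul2n -addnn; congr (_ + _).
  by apply: eq_card => B; rewrite !inE.
rewrite card_toggle_mem; apply: eq_card => B; rewrite !inE; exact: andbC.
Qed.

End ToggleElement.

(** A set [B] amounts to its preimage, which alone decides [Q], together with an arbitrary subset
    [D] of the complement of the image of [e]. *)
Lemma card_preimset_inj (I J : finType) (e : I -> J) (Q : pred {set I}) :
  injective e ->
  #|[set B : {set J} | Q (e @^-1: B)]| = #|[set C | Q C]| * 2 ^ (#|J| - #|I|).
Proof.
move=> e_inj; pose U := ~: (e @: setT).
have cU : #|U| = #|J| - #|I|.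
  by rewrite -(cardsC (e @: setT)) card_imset// cardsT addKn.
pose f (p : {set I} * {set J}) := (e @: p.1) :|: p.2.
have fpre (C : {set I}) (D : {set J}) : D \in powerset U -> e @^-1: (e @: C :|: D) = C.
  rewrite inE => /subsetP DU; apply/setP => x; rewrite !inE mem_imset//.
  case: (boolP (e x \in D)) => [/DU|]; last by rewrite orbF.
  by rewrite inE imset_f.
have fD (C : {set I}) (D : {set J}) : D \in powerset U -> (e @: C :|: D) :&: U = D.
  rewrite inE => /subsetP DU; apply/setP => y; rewrite !inE.
  case: (boolP (y \in D)) => [/DU|yD]; first by rewrite !inE orbT => ->.
  rewrite orbF; apply/negbTE/negP => /andP[/imsetP[x xC ->]].
  by rewrite imset_f.
have -> : [set B : {set J} | Q (e @^-1: B)] = f @: setX [set C | Q C] (powerset U).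
  apply/setP => B; apply/idP/imsetP => [|[[C D]]].
    rewrite inE => QB; exists (e @^-1: B, B :&: U).
      by rewrite !inE QB subsetIr.
    rewrite /f /=; apply/setP => y; rewrite !inE.
    case: (boolP (y \in B)) => yB; rewrite ?andbF ?orbF /=.
      case: (boolP (y \in e @: setT)); rewrite ?orbT// => /imsetP[x _ yE].
      by rewrite yE imset_f// inE -yE.
    by apply/esym/negbTE/negP => /imsetP[x]; rewrite inE => exB yE; rewrite yE exB in yB.
  move=> /setXP[]; rewrite inE => QC DU ->.
  by rewrite inE /f /= fpre.
rewrite card_in_imset ?cardsX ?card_powerset ?cU// => -[C D] [C' D'].
move=> /setXP[_ DU] /setXP[_ DU'] ff.
by rewrite /f /= in ff; rewrite -(fpre C D DU) -{2}(fD C D DU) ff fpre ?fD.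
Qed.

(** * Counting small subsets *)

(** With [M = 2 ^ c] this is [(1 + 1/M)^M <= 4]. Bernoulli's inequality gives
    [(1 + 1/M)^i * (1 - i/(M+1)) <= 1]; at [i = M/2] the second factor is at least 1/2, and squaring
    concludes. *)
Lemma expSn_le4 c : 0 < c -> (2 ^ c).+1 ^ (2 ^ c) <= 4 * (2 ^ c) ^ (2 ^ c).
Proof.
case: c => // c _; set M := 2 ^ c.+1; pose h := 2 ^ c.
have Mh : M = h * 2 by rewrite /M expnSr.
have bern i : M.+1 ^ i * M.+1 <= M ^ i * M.+1 + i * M.+1 ^ i.
  elim: i => [|i IH]; first by rewrite !mul1n addn0.
  have : M.+1 ^ i.+1 * M.+1 <= M.+1 * (M ^ i * M.+1 + i * M.+1 ^ i).
    by rewrite expnS -mulnA leq_mul2l IH.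
  have : M ^ i * M.+1 <= M.+1 ^ i * M.+1.
    by case: (i) => // i'; rewrite leq_mul2r leq_exp2r// leqnSn orbT.
  rewrite !expnS; move: (M.+1 ^ i) (M ^ i) => p q; nia.
have half : M.+1 ^ h <= 2 * M ^ h.
  have := bern h; have := expn_gt0 M.+1 h; nia.
by rewrite {2 4}Mh !expnM -[4]/(2 ^ 2) -expnMn leq_exp2r.
Qed.

(* Weight [D] by [M ^ (#|U| - #|D|)], where [M = 2 ^ c]: the total weight is
   [M.+1 ^ #|U|], and a set of size at most [a] weighs at least [M ^ (#|U| - a)]. *)
Lemma card_small_subsets (I : finType) (U : {set I}) (c a b : nat) : 0 < c ->
  #|U| <= 2 ^ c * b ->
  #|[set D : {set I} | D \subset U & #|D| <= a]| <= 2 ^ (c * a + 2 * b).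
Proof.
move=> c_gt0 Ub; set M := 2 ^ c; set S := [set D | _ & _].
have M_gt0 : 0 < M by rewrite expn_gt0.
have sumM : \sum_(D in powerset U) M ^ (#|U| - #|D|) = M.+1 ^ #|U|.
  rewrite -addn1 expnDn (partition_big (fun D : {set I} => inord #|D| : 'I_(#|U|.+1)) predT)//=.
  apply: eq_bigr => i _; rewrite exp1n muln1 -cards_draws -sum_nat_const.
  have inordE (D : {set I}) : D \subset U -> (inord #|D| == i) = (#|D| == i).
    by move=> DU; rewrite -val_eqE /= inordK// ltnS; exact: subset_leq_card.
  apply: eq_big => D; first by rewrite !inE; apply: andb_id2l => /inordE.
  by rewrite inE => /andP[/inordE ->] /eqP->.
  have SM : #|S| * M ^ #|U| <= M ^ a * M.+1 ^ #|U|.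
  rewrite -sumM -sum_nat_const big_distrr /= [leqRHS](big_setID S)/=.
  apply: leq_trans (leq_addr _ _).
  rewrite (_ : powerset U :&: S = S); last first.
    by apply/setP => D; rewrite !inE andbA andbb.
  apply: leq_sum => D; rewrite inE => /andP[DU Da].
  by rewrite -expnD leq_pexp2l//; have := subset_leq_card DU; lia.
have M4 : M.+1 ^ (M * b) <= 4 ^ b * M ^ (M * b).
  rewrite !expnM -expnMn; case: (b) => // b'; rewrite leq_exp2r//; exact: expSn_le4.
have {}M4 : M.+1 ^ #|U| <= 4 ^ b * M ^ #|U|.
  rewrite -(@leq_pmul2r (M ^ (M * b - #|U|))) ?expn_gt0 ?M_gt0//.
  rewrite -mulnA -expnD subnKC//; apply: leq_trans M4.
  rewrite -[in leqRHS](subnKC Ub) expnD leq_mul2l; apply/orP; right.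
  by case: (M * b - _) => // e; rewrite leq_exp2r.
rewrite -(@leq_pmul2r (M ^ #|U|)) ?expn_gt0 ?M_gt0//.
apply: (leq_trans SM); rewrite expnD !expnM -mulnA leq_mul2l M4 orbT //.
Qed.

(* The ordinal [i] stands for the positive integer [i + 1], so that
   [(i + 1) + (j + 1) = t + 1] reads [(i + j).+1 = t]. *)
Definition unsummed n (B : {set 'I_n}) (t : nat) : bool :=
  [forall i in B, forall j in B, (i + j).+1 != t].

Definition unsummed_set n (B : {set 'I_n}) : {set 'I_n} := [set t : 'I_n | unsummed B t].

Lemma unsummedP n (B : {set 'I_n}) (t : nat) :
  reflect (forall i j, i \in B -> j \in B -> (i + j).+1 <> t) (unsummed B t).
Proof.
apply: (iffP forall_inP) => [H i j iB jB|H i iB].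
  by apply/eqP; have /forall_inP := H i iB; apply.
by apply/forall_inP => j jB; apply/eqP; exact: H.
Qed.

(** The pairs [{p, t - p.+1}] with [p < t./2] are disjoint, and [B] contains none of them entirely,
    which leaves 3 of the 4 possibilities for each. [Q p] imposes this on the first [p] pairs only,
    so the next pair [u], [v] is still free. *)
Lemma card_unsummed n (t : nat) : t < n ->
  #|[set B : {set 'I_n} | unsummed B t]| * 4 ^ t./2 <= 3 ^ t./2 * 2 ^ n.
Proof.
move=> tn.
pose Q p (B : {set 'I_n}) :=
  [forall i in B, forall j in B, ~~ ((i < p) && ((i + j).+1 == t))].
have QP p (B : {set 'I_n}) :
    reflect (forall i j, i \in B -> j \in B -> i < p -> (i + j).+1 <> t) (Q p B).
  apply: (iffP forall_inP) => [H i j iB jB ip|H i iB].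
    by have /forall_inP/(_ _ jB) := H i iB; rewrite ip => /eqP.
  by apply/forall_inP => j jB; apply/negP => /andP[ip /eqP]; exact: H.
have Qcard p : p <= t./2 -> #|[set B | Q p B]| * 4 ^ p = 3 ^ p * 2 ^ n; last first.
  rewrite -(Qcard _ (leqnn _)) leq_mul2r; apply/orP; right.
  apply/subset_leq_card/subsetP => B; rewrite !inE => /unsummedP H.
  by apply/QP => i j iB jB _; exact: H.
elim: p => [_|p IH pt].
  rewrite expn0 muln1 mul1n -[X in 2 ^ X]card_ord -cardsT -card_powerset.
  by apply: eq_card => B; rewrite !inE subsetT; apply/QP.
have pn : p < n by lia.
have qn : t - p.+1 < n by lia.
pose u : 'I_n := Ordinal pn; pose v : 'I_n := Ordinal qn.
have Qext (B B' : {set 'I_n}) :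
    (forall x : 'I_n, x != u -> x != v -> (x \in B) = (x \in B')) -> Q p B = Q p B'.
  have imp (C C' : {set 'I_n}) :
      (forall x : 'I_n, x != u -> x != v -> (x \in C) = (x \in C')) -> Q p C -> Q p C'.
    move=> CC' /QP H; apply/QP => i j iC jC ip ijt.
    have [iu iv] : i != u /\ i != v by split; apply/eqP => /(congr1 val)/=; lia.
    have [ju jv] : j != u /\ j != v by split; apply/eqP => /(congr1 val)/=; lia.
    by apply: (H i j) => //; rewrite CC'.
  by move=> BB'; apply/idP/idP; apply: imp => x xu xv; rewrite BB'.
have Su : #|[set B | Q p B]| = 2 * #|[set B : {set 'I_n} | Q p B & u \in B]|.
  by apply: card_toggle => B; apply: Qext => x xu _; rewrite !inE (negbTE xu).
have Sv : #|[set B : {set 'I_n} | Q p B & u \in B]|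
    = 2 * #|[set B : {set 'I_n} | (Q p B && (u \in B)) && (v \in B)]|.
  apply: (@card_toggle _ _ (fun B => Q p B && (u \in B))) => B; congr (_ && _).
    by apply: Qext => x _ xv; rewrite !inE (negbTE xv).
  have uv : u != v by apply/eqP => /(congr1 val)/=; lia.
  by rewrite !inE (negbTE uv).
have split3 : #|[set B | Q p B]| = #|[set B | Q p.+1 B]|
    + #|[set B : {set 'I_n} | (Q p B && (u \in B)) && (v \in B)]|.
  rewrite -(cardsID [set B : {set 'I_n} | ~~ ((u \in B) && (v \in B))]); congr (_ + _).
    apply: eq_card => B; rewrite !inE; apply/idP/idP.
      move=> /andP[/QP H uv]; apply/QP => i j iB jB.
      rewrite ltnS leq_eqVlt => /orP[/eqP ip|]; last exact: H.
      move=> ijt; move: uv; rewrite (_ : u = i) ?iB; last exact: val_inj.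
      by rewrite (_ : v = j) ?jB//; apply: val_inj => /=; lia.
    move=> /QP H; apply/andP; split; first by apply/QP => i j iB jB ip; apply: H => //; lia.
    by apply/negP => /andP[uB vB]; apply: (H u v) => //=; lia.
  by apply: eq_card => B; rewrite !inE negbK andbC andbA.
have := IH (ltnW pt); rewrite !expnS; nia.
Qed.

(** * Containers for independent sets *)

Section Container.
Variables (V : finType) (e : rel V) (W : {set V}) (d phi : nat).
Hypotheses (e_sym : symmetric e) (phi_gt0 : 0 < phi)
  (degW : forall x, x \in W -> #|[set z | e x z]| = d)
  (deg_le : forall x, #|[set z | e x z]| <= d).

Definition nbhd (F : {set V}) : {set V} := [set z | [exists x in F, e x z]].

Definition container (F : {set V}) : {set V} :=
  [set v | (v \notin nbhd F) &&
    ((v \in W) ==> (#|[set z | e v z] :\: nbhd F| < phi))].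

(** The second condition keeps [F] smaller than its neighbourhood by a factor [phi]; hence there are
    few fingerprints, and few containers. *)
Definition fingerprint (F : {set V}) := (F \subset W) && (#|F| * phi <= #|nbhd F|).

(* The fingerprint is a maximal subset of [B :&: W] each of whose elements
   contributes [phi] new neighbours on average. *)
Lemma container_exists (B : {set V}) : {in B &, forall x z, ~~ e x z} ->
  exists2 F, fingerprint F & B \subset container F.
Proof.
move=> indB.
pose P (F : {set V}) := (F \subset B :&: W) && (#|F| * phi <= #|nbhd F|).
have P0 : P set0 by rewrite /P sub0set cards0.
have [F /maxsetP[/andP[FBW Fphi] Fmax] _] := maxset_exists P0.
exists F; first by rewrite /fingerprint Fphi andbT (subset_trans FBW) ?subsetIr.
apply/subsetP => v vB; rewrite inE; apply/andP; split.
  rewrite inE; apply/negP => /exists_inP[x /(subsetP FBW)].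
  by rewrite inE => /andP[xB _]; rewrite (negbTE (indB _ _ xB vB)).
apply/implyP => vW; rewrite ltnNge; apply/negP => phile.
have nbU : nbhd (v |: F) = nbhd F :|: ([set z | e v z] :\: nbhd F).
  apply/setP => z; rewrite !inE; apply/exists_inP/idP => [[x]|].
    rewrite !inE => /orP[/eqP->|xF] xz; first by rewrite xz andbT orbN.
    by apply/orP; left; apply/exists_inP; exists x.
  case: (boolP [exists x in F, e x z]) => [/exists_inP[x xF xz] _|_ /= vz].
    by exists x => //; rewrite !inE xF orbT.
  by exists v => //; rewrite !inE eqxx.
have cU : #|nbhd (v |: F)| = #|nbhd F| + #|[set z | e v z] :\: nbhd F|.
  rewrite nbU cardsU (_ : _ :&: _ = set0) ?cards0 ?subn0//.
  by apply/setP => z; rewrite !inE; case: [exists x in F, e x z].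
have vF : v \notin F.
  apply/negP => vF; move: phile; rewrite leqNgt (_ : _ :\: _ = set0) ?cards0 ?phi_gt0//.
  apply/setP => z; rewrite !inE; apply/negbTE/negP => /andP[/exists_inP H vz].
  by apply: H; exists v.
have : P (v |: F).
  rewrite /P subUset sub1set inE vB vW FBW /= cU cardsU1 vF mulnDl mul1n addnC.
  exact: leq_add.
move=> /Fmax /(_ (subsetUr _ _)) FE; move: vF; rewrite -{1}FE; by rewrite setU11.
Qed.

(** Count the edges between [S] and [N]: a vertex of [S] has degree [d] and fewer than [phi]
    neighbours outside [N], while a vertex of [N] has degree at most [d]. So [N] cannot be much
    smaller than [S], and [N] is disjoint from the container. *)
Lemma card_container F : phi <= d ->
  (2 * d - phi) * #|container F| + (d - phi) * #|W| <= (2 * d - phi) * #|V|.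
Proof.
move=> phid; set C := container F; set N := nbhd F; pose S := C :&: W.
have CN : #|C| + #|N| <= #|V|.
  rewrite -cardsUI (_ : _ :&: _ = set0) ?cards0 ?addn0 ?max_card//.
  by apply/setP => z; rewrite /C /N !inE; case: [exists x in F, e x z]; rewrite ?andbF.
have CW : #|C| + #|W| <= #|V| + #|S|.
  by rewrite -cardsUI leq_add2r max_card.
have SN : #|S| * (d - phi) <= #|N| * d.
  rewrite -!sum_nat_const.
  apply: (@leq_trans (\sum_(v in S) #|[set z | e v z] :&: N|)).
    apply: leq_sum => v; rewrite !inE => /andP[/andP[_ H] vW].
    by move: H; rewrite vW /= -/N => H; rewrite -(degW vW) -(cardsID N [set z | e v z]); lia.
  under eq_bigr => v _ do rewrite -sum1_card.
  rewrite (exchange_big_dep (mem N))/=; last by move=> v z _; rewrite inE => /andP[].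
  apply: leq_sum => z zN; rewrite sum1_card.
  apply: leq_trans (deg_le z); apply/subset_leq_card/subsetP => v.
  by rewrite unfold_in => /andP[_ /setIP[+ _]]; rewrite !inE e_sym.
nia.
Qed.

End Container.

(** * Sum graphs and their independent sets *)

Definition initial n (m : nat) : {set 'I_n} := [set x : 'I_n | x < m].

Lemma card_initial n m : #|initial n m| = minn n m.
Proof.
rewrite -sum1_card big_mkcond (eq_bigr (fun i : 'I_n => (i < m : nat))); last first.
  by move=> i _; rewrite inE; case: ltnP.
rewrite -(big_mkord predT (fun i => (i < m : nat))).
elim: n => [|n IH]; first by rewrite big_geq// min0n.
by rewrite big_nat_recr//= IH; lia.
Qed.

Lemma leq_card_bigcup (I T : finType) (P : pred I) (F : I -> {set T}) :
  #|\bigcup_(i | P i) F i| <= \sum_(i | P i) #|F i|.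
Proof.
elim/big_rec2: _ => [|i k A _ IH]; first by rewrite cards0.
by apply: leq_trans (leq_card_setU _ _).1 _; rewrite leq_add2l.
Qed.

Lemma card_small_trace (I : finType) (W : {set I}) (a : nat) :
  #|[set B : {set I} | #|B :&: W| <= a]| <=
  #|[set D : {set I} | D \subset W & #|D| <= a]| * 2 ^ #|~: W|.
Proof.
rewrite -card_powerset -cardsX.
have f_inj : injective (fun B : {set I} => (B :&: W, B :&: ~: W)).
  by move=> B B' [BW BW']; rewrite -(setID B W) -(setID B' W) !setDE BW BW'.
rewrite -(card_imset _ f_inj); apply/subset_leq_card/subsetP => _ /imsetP[B + ->].
by rewrite !inE /= => ->; rewrite !subsetIr.
Qed.

Section SumGraph.
Variables (n m H : nat) (Y : {set 'I_n.+1}).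
Hypothesis YmH : {in Y, forall y : 'I_n.+1, m <= y < H}.

(** Loops are allowed, matching the sums [a + a]: an independent set contains no vertex with a
    loop. *)
Definition sum_rel (x z : 'I_n.+1) := [exists y in Y, (x + z).+1 == y :> nat].

Lemma sum_relP (x z : 'I_n.+1) :
  reflect (exists2 y : 'I_n.+1, y \in Y & (x + z).+1 = y) (sum_rel x z).
Proof. by apply: (iffP exists_inP) => -[y yY /eqP]; exists y => //; apply/eqP. Qed.

Lemma sum_rel_sym : symmetric sum_rel.
Proof. by move=> x z; rewrite /sum_rel addnC. Qed.

Lemma sum_rel_deg_le x : #|[set z | sum_rel x z]| <= #|Y|.
Proof.
rewrite -(card_in_imset (f := fun z : 'I_n.+1 => inord (x + z).+1 : 'I_n.+1)).
  apply/subset_leq_card/subsetP => _ /imsetP[z + ->].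
  by rewrite inE => /sum_relP[y yY ->]; rewrite inord_val.
move=> z z'; rewrite !inE => /sum_relP[y yY E] /sum_relP[y' yY' E'] /(congr1 val).
by rewrite /= E E' !inord_val => yy'; apply: val_inj => /=; lia.
Qed.

(** Every [y] in [Y] is at least [m > x], so it yields the neighbour [y - x.+1], and different [y]
    yield different neighbours. *)
Lemma sum_rel_deg x : x \in initial n.+1 m -> #|[set z | sum_rel x z]| = #|Y|.
Proof.
rewrite inE => xm; apply/eqP; rewrite eqn_leq sum_rel_deg_le.
rewrite andTb -(card_in_imset (f := fun y : 'I_n.+1 => inord (y - x.+1) : 'I_n.+1) (D := mem Y)).
  apply/subset_leq_card/subsetP => _ /imsetP[y yY ->].
  rewrite inE; apply/sum_relP; exists y => //; rewrite inordK;
    have := YmH yY; have := ltn_ord y; lia.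
move=> y y' yY y'Y /(congr1 val); rewrite /= !inordK;
  have := YmH yY; have := YmH y'Y; have := ltn_ord y; have := ltn_ord y'; try lia.
by move=> *; apply: val_inj => /=; lia.
Qed.

(** These [B] are independent in the sum graph, so each lies in the container of some fingerprint
    [F]. Only vertices below [H] have neighbours, whence [#|F| <= a]; by [card_container] every
    container misses at least [X] vertices. *)
Lemma card_unsummed_on (phi X a : nat) : 0 < phi <= #|Y| -> H <= a * phi ->
  (2 * #|Y| - phi) * X <= (#|Y| - phi) * #|initial n.+1 m| ->
  #|[set B : {set 'I_n.+1} | [forall y in Y, unsummed B (y : 'I_n.+1)]]|
  <= #|[set F : {set 'I_n.+1} | F \subset initial n.+1 m & #|F| <= a]| * 2 ^ (n.+1 - X).
Proof.
move=> /andP[phi0 phiY] Ha HX; set W := initial n.+1 m.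
set FF := [set F | _ & _].
apply: (@leq_trans #|\bigcup_(F in FF) powerset (container sum_rel W phi F)|); last first.
  apply: leq_trans (leq_card_bigcup _ _) _.
  rewrite -sum_nat_const; apply: leq_sum => F _.
  rewrite card_powerset leq_pexp2l//.
  have := card_container sum_rel_sym phi0 sum_rel_deg sum_rel_deg_le F phiY.
  rewrite card_ord; set C := #|container _ _ _ _| => HC.
  suff : (2 * #|Y| - phi) * (C + X) <= (2 * #|Y| - phi) * n.+1.
    by rewrite leq_pmul2l; [lia | move: phi0 phiY; lia].
  by rewrite mulnDr; apply: leq_trans HC; rewrite leq_add2l.
apply/subset_leq_card/subsetP => B; rewrite inE => /forall_inP BY.
have [|F FP BC] := @container_exists _ sum_rel W phi phi0 B.
  move=> x z xB zB; apply/negP => /sum_relP[y yY E].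
  by have /unsummedP/(_ _ _ xB zB) := BY y yY.
apply/bigcupP; exists F; last by rewrite powersetE.
move: FP => /andP[FW Fphi]; rewrite inE FW /= -(@leq_pmul2r phi)//.
apply: leq_trans Fphi _; apply: leq_trans Ha.
apply: (@leq_trans #|initial n.+1 H|); last by rewrite card_initial geq_minr.
apply/subset_leq_card/subsetP => z; rewrite !inE => /exists_inP[x _ /sum_relP[y yY E]].
by have := YmH yY; lia.
Qed.

End SumGraph.

(** Union bound over the [j]-element sets [Y] of missing numbers in [[m, H)]. The family of sets [Y]
    is then enlarged to the form that [card_small_subsets] counts. *)
Lemma card_many_unsummed (n m H phi X a j : nat) : 0 < phi <= j -> H <= a * phi ->
  m <= n.+1 -> (2 * j - phi) * X <= (j - phi) * m ->
  #|[set B : {set 'I_n.+1} | j <= #|unsummed_set B :&: (initial n.+1 H :\: initial n.+1 m)|]|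
  <= #|[set Y : {set 'I_n.+1} | Y \subset initial n.+1 H & #|Y| <= j]| *
     (#|[set F : {set 'I_n.+1} | F \subset initial n.+1 m & #|F| <= a]| * 2 ^ (n.+1 - X)).
Proof.
move=> phij Ha mn HX.
pose YY := [set Y : {set 'I_n.+1} | Y \subset initial n.+1 H :\: initial n.+1 m & #|Y| == j].
apply: (@leq_trans #|\bigcup_(Y in YY)
   [set B : {set 'I_n.+1} | [forall y in Y, unsummed B (y : 'I_n.+1)]]|).
  apply/subset_leq_card/subsetP => B; rewrite inE => jB.
  have [Y [cY YU]] : exists Y : {set 'I_n.+1}, #|Y| = j /\
      Y \subset unsummed_set B :&: (initial n.+1 H :\: initial n.+1 m).
    move: jB; set U := _ :&: _ => jU.
    have : 0 < #|[set Y : {set 'I_n.+1} | Y \subset U & #|Y| == j]|.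
      by rewrite cards_draws bin_gt0.
    by move=> /card_gt0P[Y]; rewrite inE => /andP[YU /eqP]; exists Y.
  apply/bigcupP; exists Y; first by rewrite inE cY eqxx andbT (subset_trans YU) ?subsetIr.
  by rewrite inE; apply/forall_inP => y /(subsetP YU); rewrite inE => /andP[]; rewrite inE.
apply: leq_trans (leq_card_bigcup _ _) _.
apply: (@leq_trans (#|YY| * (#|[set F : {set 'I_n.+1} | F \subset initial n.+1 m & #|F| <= a]|
   * 2 ^ (n.+1 - X)))).
  rewrite -[leqRHS]sum_nat_const; apply: leq_sum => Y; rewrite inE => /andP[/subsetP YmH /eqP cY].
  apply: (@card_unsummed_on n m H Y _ phi X a); rewrite ?cY//.
    by move=> y /YmH; rewrite !inE -leqNgt.
  by rewrite card_initial (minn_idPr mn).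
rewrite leq_mul2r; apply/orP; right; apply/subset_leq_card/subsetP => Y.
rewrite !inE => /andP[YH /eqP->]; rewrite leqnn andbT.
by rewrite (subset_trans YH) ?subsetDl.
Qed.

(** As [ord0] stands for 1, an element [b] of [B] makes [b.+1] a sum. The successor thus maps the
    trace of [B] into the summed indices below [m], except for the last index [(minn n.+1 m).-1],
    which costs the extra 1. *)
Lemma card_trace_le n m (B : {set 'I_n.+1}) : ord0 \in B ->
  #|B :&: initial n.+1 m| + #|unsummed_set B :&: initial n.+1 m| <= m.+1.
Proof.
move=> B0; set W := initial n.+1 m.
have W_le : #|W| <= m by rewrite card_initial geq_minr.
suff : #|B :&: W| <= #|W :\: unsummed_set B| + 1.
  by have := cardsID (unsummed_set B) W; rewrite setIC; lia.
pose f (t : 'I_n.+1) : 'I_n.+1 := inord t.-1.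
have BW : B :&: W \subset f @: (W :\: unsummed_set B) :|: [set inord (minn n.+1 m).-1].
  apply/subsetP => b; rewrite !inE => /andP[bB bm].
  have := ltn_ord b => bn.
  case: (ltnP b.+1 (minn n.+1 m)) => bm1; last first.
    by apply/orP; right; apply/eqP/val_inj; rewrite /= inordK; lia.
  apply/orP; left; apply/imsetP; exists (inord b.+1); last first.
    by rewrite /f inordK ?inord_val//; lia.
  rewrite !inE inordK; last lia.
  rewrite andbC (_ : b.+1 < m); last lia.
  by apply/negP => /unsummedP/(_ _ _ B0 bB).
apply: leq_trans (subset_leq_card BW) _; apply: leq_trans (leq_card_setU _ _).1 _.
by rewrite cards1 leq_add2r leq_imset_card.
Qed.

(** * Subsets whose least element is the first one *)

Local Open Scope ring_scope.

Lemma geometric_tail_le (F : realFieldType) (a : F) (n H : nat) : 0 <= a < 1 ->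
  \sum_(t < n | (H <= t)%N) a ^+ t <= a ^+ H / (1 - a).
Proof.
move=> /andP[a_ge0 a_lt1].
have a1 : 0 < 1 - a by rewrite subr_gt0.
rewrite ler_pdivlMr//.
(* Keeping the remainder of the telescoping sum makes the induction on [n] go through. *)
suff : (\sum_(t < n | (H <= t)%N) a ^+ t) * (1 - a) + a ^+ maxn n H <= a ^+ H.
  by apply: le_trans; rewrite lerDl exprn_ge0.
rewrite -(big_mkord (fun t => H <= t)%N (fun t => a ^+ t)).
elim: n => [|n IH]; first by rewrite big_geq// max0n mul0r add0r.
rewrite big_mkcond big_nat_recr//= -big_mkcond /=.
case: leqP IH => Hn IH; last by rewrite addr0 (maxn_idPr _).
by rewrite (maxn_idPl _) ?exprS; [lra | lia].
Qed.

Lemma card_late_unsummed (F : realFieldType) (n j : nat) :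
  #|[set B : {set 'I_n} | [exists t : 'I_n, (3072 * j <= t)%N && unsummed B t]]|%:R * 2 ^+ (514 * j)
  <= 16 * 2 ^+ n :> F.
Proof.
(* With [a = 7/8], [(3/4)^(t./2) <= 2 * a^t], where the 2 pays for odd [t]. The tail sum contributes
   [1/(1 - a) = 8], giving 16 in all, and [3072 >= 11 * 257] turns [a ^+ 11 <= 1/4] into the factor
   [2^(-514 j)]. *)
have [a [a_ge0 a_lt1 a8 a2 a11]] : exists a : F,
    [/\ 0 <= a, a < 1, 8 * a = 7, 3 / 4 <= a ^+ 2 & a ^+ 11 * 2 ^+ 2 <= 1].
  by exists (7 / 8); split; lra.
set H := (3072 * j)%N.
pose U (t : 'I_n) := [set B : {set 'I_n} | unsummed B t].
have Ut (t : 'I_n) : #|U t|%:R <= 2 * a ^+ t * 2 ^+ n :> F.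
  have := card_unsummed (ltn_ord t).
  rewrite -(ler_nat F) !natrM !natrX -/(U t) => Hu.
  have {}Hu : #|U t|%:R <= (3 / 4) ^+ t./2 * 2 ^+ n :> F.
    by rewrite expr_div_n mulrAC ler_pdivlMr// exprn_gt0.
  apply: (le_trans Hu); rewrite ler_pM2r ?exprn_gt0//.
  rewrite -[X in a ^+ X]odd_double_half exprD -mul2n exprM mulrA.
  rewrite -[leLHS]mul1r; apply: ler_pM; rewrite ?exprn_ge0//; [lra | by case: (odd t); lra |].
  by apply: lerXn2r; rewrite ?nnegrE ?exprn_ge0//; lra.
have aH : a ^+ H * 2 ^+ (514 * j) <= 1.
  have -> : H = (11 * (257 * j) + 245 * j)%N by rewrite /H; lia.
  rewrite (_ : 514 * j = 2 * (257 * j))%N; last lia.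
  rewrite exprD (exprM a 11) (exprM 2 2) mulrAC -exprMn.
  by rewrite mulr_ile1 ?exprn_ge0 ?exprn_ile1 ?mulr_ge0 ?exprn_ge0// ltW.
have -> : 16 * 2 ^+ n = 16 * 2 ^+ n * 1 :> F by rewrite mulr1.
apply: (@le_trans _ _ (16 * 2 ^+ n * (a ^+ H * 2 ^+ (514 * j)))); last first.
  by rewrite ler_pM2l// mulr_gt0// exprn_gt0.
rewrite [leRHS]mulrA ler_pM2r ?exprn_gt0//.
apply: (@le_trans _ _ (\sum_(t < n | (H <= t)%N) #|U t|)%:R).
  rewrite ler_nat; apply: leq_trans (leq_card_bigcup _ _).
  apply/subset_leq_card/subsetP => B.
  by rewrite inE => /existsP[t /andP[Ht Bt]]; apply/bigcupP; exists t; rewrite ?inE.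
rewrite natr_sum.
apply: (@le_trans _ _ (\sum_(t < n | (H <= t)%N) 2 * a ^+ t * 2 ^+ n)); first exact: ler_sum.
rewrite -mulr_suml -mulr_sumr [leRHS]mulrAC ler_pM2r ?exprn_gt0//.
have := @geometric_tail_le F a n H; rewrite a_ge0 a_lt1 => /(_ isT).
have -> : 1 - a = 8^-1 by lra.
by rewrite invrK; lra.
Qed.

Definition sets_with_first n k : {set {set 'I_n.+1}} :=
  [set B : {set 'I_n.+1} | (ord0 \in B) && (k <= #|unsummed_set B|)%N].

(* With k = 1024 j: m = 17k/16 and H = 3k. In [card_many] there are at most
   2^(16 j) sets Y and 2^(14 j) fingerprints, each giving a container of size
   about N - 544 j; the total 2^(N - 514 j) beats 2^(N - k/2) = 2^(N - 512 j). *)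
Section SetsWithFirst.
Variables (n j phi : nat).
(* [phi] stays a variable so that [2 ^+ (544 * phi)] is never computed. *)
Hypothesis phiE : phi = 3072%N.
Let N := n.+1.
Let m := (1088 * j)%N.
Let H := (3072 * j)%N.

Let late := [set B : {set 'I_N} | [exists t : 'I_N, (H <= t)%N && unsummed B t]].
Let many := [set B : {set 'I_N} | (j <= #|unsummed_set B :&: (initial N H :\: initial N m)|)%N].
Let sparse := [set B : {set 'I_N} | (#|B :&: initial N m| <= 65 * j)%N].

(** Outside [late] and [many], fewer than [j] missing indices are at least [m], so at least
    [1023 j + 1] lie below [m = 1088 j]. By [card_trace_le] at most [65 j] elements of [B] remain
    there. *)
Lemma sets_with_first_sub : sets_with_first n (1024 * j) \subset late :|: many :|: sparse.
Proof.
apply/subsetP => B; rewrite inE => /andP[B0 Bk]; rewrite !in_setU.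
case: (boolP (B \in late)) => //= Blate; case: (boolP (B \in many)) => //= Bmany.
move: Bmany; rewrite !inE -ltnNge => Bmany.
have := card_trace_le m B0.
have BH : unsummed_set B \subset initial N H.
  apply/subsetP => t tB; rewrite inE ltnNge; apply/negP => Ht; move: Blate; rewrite inE.
  by move=> /existsP[]; exists t; rewrite Ht; move: tB; rewrite inE.
have := cardsID (initial N m) (unsummed_set B).
have <- : unsummed_set B :&: (initial N H :\: initial N m) = unsummed_set B :\: initial N m.
  by rewrite setIDA (setIidPl BH).
rewrite -/N in Bmany Bk *; move: Bk Bmany; rewrite /m; lia.
Qed.

Lemma card_many : (phi <= j)%N -> (#|many| * 2 ^ (514 * j) <= 2 ^ (544 * phi + N))%N.
Proof.
move=> phij.
have [mN|Nm] := leqP m N; last first.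
  have -> : many = set0; last by rewrite cards0.
  apply/setP => B; rewrite !inE (_ : _ :\: _ = set0) ?setI0 ?cards0; first by lia.
  by apply/setP => t; rewrite !inE; have := ltn_ord t; lia.
(* As [phi = 3072], [H = j * phi], so fingerprints have at most [j] elements. The choice
   [X = 544 (j - phi)] is half of [m] minus a constant, and is admissible because
   [544 (2 j - phi) <= 1088 j]. *)
have := @card_many_unsummed n m H phi (544 * (j - phi)) j j.
rewrite phij andbT -/many => /(_ _ _ mN _) Hm.
have {}Hm := Hm ltac:(lia) ltac:(rewrite /H; lia) ltac:(rewrite /m; nia).
have smallY : (#|[set Y : {set 'I_N} | Y \subset initial N H & #|Y| <= j]|
    <= 2 ^ (10 * j + 2 * (3 * j)))%N.
  by apply: card_small_subsets => //; rewrite card_initial (_ : 2 ^ 10 = 1024)%N//; lia.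
have smallF : (#|[set Y : {set 'I_N} | Y \subset initial N m & #|Y| <= j]|
    <= 2 ^ (10 * j + 2 * (2 * j)))%N.
  by apply: card_small_subsets => //; rewrite card_initial (_ : 2 ^ 10 = 1024)%N//; lia.
apply: (@leq_trans (2 ^ (10 * j + 2 * (3 * j)) *
    (2 ^ (10 * j + 2 * (2 * j)) * 2 ^ (N - 544 * (j - phi))) * 2 ^ (514 * j))%N).
  rewrite leq_mul2r; apply/orP; right; apply: (leq_trans Hm).
  by apply: leq_mul => //; rewrite leq_mul2r smallF orbT.
by rewrite -!expnD leq_pexp2l//; move: mN; rewrite /m; lia.
Qed.

(** The trace below [m] takes at most [2^(467 j)] values, and [467 + 514 = 981 < 1024] leaves room
    even if [N < m]. *)
Lemma card_sparse : (1024 * j <= N)%N -> (#|sparse| * 2 ^ (514 * j) <= 2 ^ N)%N.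
Proof.
move=> kN; pose W := initial N m.
have smallW : (#|[set D : {set 'I_N} | D \subset W & #|D| <= 65 * j]|
    <= 2 ^ (3 * (65 * j) + 2 * (136 * j)))%N.
  by apply: card_small_subsets => //; rewrite card_initial; lia.
apply: (@leq_trans (2 ^ (3 * (65 * j) + 2 * (136 * j)) * 2 ^ #|~: W| * 2 ^ (514 * j))%N).
  rewrite leq_mul2r; apply/orP; right; apply: (leq_trans (card_small_trace W (65 * j))).
  by rewrite leq_mul2r smallW orbT.
rewrite -!expnD leq_pexp2l//.
have := cardsC W; rewrite card_ord card_initial /m; lia.
Qed.

(** The 17 collects 16 from [late] and 1 from [sparse]. For [j < phi] the term [2 ^+ (544 * phi)]
    alone makes the bound trivial. *)
Lemma card_sets_with_first (F : realFieldType) :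
  #|sets_with_first n (1024 * j)|%:R * 2 ^+ (514 * j) <= (2 ^+ (544 * phi) + 17) * 2 ^+ N :> F.
Proof.
have [jphi|phij] := ltnP j phi.
  have card_le : #|sets_with_first n (1024 * j)|%:R <= 2 ^+ N :> F.
    rewrite -natrX ler_nat -[X in (2 ^ X)%N]card_ord -cardsT -card_powerset.
    by apply/subset_leq_card/subsetP => B _; rewrite powersetE subsetT.
  rewrite mulrC; apply: ler_pM; rewrite ?exprn_ge0//.
  apply: (@le_trans _ _ (2 ^+ (544 * phi))); last by rewrite lerDl.
  by rewrite ler_eXn2l ?ltr1n//; lia.
have [Nk|kN] := ltnP N (1024 * j).
  have -> : sets_with_first n (1024 * j) = set0.
    apply/setP => B; rewrite !inE; apply/negbTE; rewrite negb_and -ltnNge.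
    by apply/orP; right; apply: leq_ltn_trans Nk; rewrite -[X in (_ <= X)%N]card_ord max_card.
  by rewrite cards0 mul0r mulr_ge0 ?addr_ge0 ?exprn_ge0.
have lateP := card_late_unsummed F N j.
have manyP : #|many|%:R * 2 ^+ (514 * j) <= 2 ^+ (544 * phi) * 2 ^+ N :> F.
  by rewrite -exprD -!natrX -natrM ler_nat card_many.
have sparseP : #|sparse|%:R * 2 ^+ (514 * j) <= 2 ^+ N :> F.
  by rewrite -!natrX -natrM ler_nat card_sparse.
apply: (@le_trans _ _ ((#|late|%:R + #|many|%:R + #|sparse|%:R) * 2 ^+ (514 * j))); last first.
  rewrite -/late in lateP; rewrite !mulrDl; lra.
rewrite ler_pM2r ?exprn_gt0// -!natrD ler_nat.
apply: leq_trans (subset_leq_card sets_with_first_sub) _.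
apply: leq_trans (leq_card_setU _ _).1 _; rewrite leq_add2r.
exact: (leq_card_setU _ _).1.
Qed.

End SetsWithFirst.

From mathcomp Require Import all_classical all_reals all_analysis.
Import Order.TTheory GRing.Theory Num.Theory.
Local Open Scope ring_scope.

(** * The recursion in the number of missing sums *)

Lemma card_unsummed_set n (B : {set 'I_n}) : #|unsummed_set B| = (\sum_(t < n) unsummed B t)%N.
Proof.
by rewrite -sum1_card big_mkcond; apply: eq_bigr => t _; rewrite inE; case: unsummed.
Qed.

(** Lowers each element by one. The top index [n.+1] is lost, harmlessly: when [ord0] is absent, it
    enters only sums that are out of range. *)
Definition unshift n (B : {set 'I_n.+2}) : {set 'I_n} :=
  (fun i : 'I_n => inord i.+1 : 'I_n.+2) @^-1: B.

(** The two new missing indices are 0 and 1, the integers 1 and 2; the index [t] after unshifting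
    corresponds to [t + 2] before. *)
Lemma card_unsummed_unshift n (B : {set 'I_n.+2}) : ord0 \notin B ->
  #|unsummed_set B| = #|unsummed_set (unshift B)|.+2.
Proof.
move=> B0.
have Bgt0 i : i \in B -> (0 < i)%N.
  by move=> iB; rewrite lt0n; apply: contra B0 => /eqP i0;
    rewrite -(_ : i = ord0)//; exact: val_inj.
rewrite !card_unsummed_set !big_ord_recl -[RHS]addn2 addnA addnC; congr (_ + _)%N; last first.
  rewrite [unsummed B ord0](_ : _ = true); last by apply/unsummedP.
  rewrite [unsummed B _](_ : _ = true)//; apply/unsummedP => i j /Bgt0 + /Bgt0 /=.
  by rewrite /bump; lia.
apply: eq_bigr => t _; congr nat_of_bool; apply/unsummedP/unsummedP => /= Bt i j.
  rewrite !inE => iB jB ijt; apply: (Bt _ _ iB jB).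
  by rewrite /bump !leq0n; have := ltn_ord i; have := ltn_ord j => jn iN; rewrite !inordK; lia.
move=> iB jB; have := Bgt0 _ iB; have := Bgt0 _ jB; have := ltn_ord t => tn j0 i0 ijt.
rewrite /bump in ijt.
have i'n : (i.-1 < n)%N by lia.
have j'n : (j.-1 < n)%N by lia.
apply: (Bt (Ordinal i'n) (Ordinal j'n)); rewrite ?inE /= ?prednK ?inord_val//.
lia.
Qed.

Definition count_missing n k : nat := #|[set B : {set 'I_n} | (k <= #|unsummed_set B|)%N]|.

(** Among the sets without [ord0], [unshift] is two-to-one, since it ignores the top index; this
    gives the factor 2. The sets with [ord0] form the other term. *)
Lemma count_missing_rec n k :
  count_missing n.+2 k.+2 = (2 * count_missing n k + #|sets_with_first n.+1 k.+2|)%N.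
Proof.
pose Q (B : {set 'I_n.+2}) := (k <= #|unsummed_set (unshift B)|)%N.
have Q0 (B : {set 'I_n.+2}) : Q (ord0 |: B) = Q (B :\ ord0).
  congr (_ <= #|unsummed_set _|)%N; apply/setP => i; rewrite !inE.
  by rewrite (_ : inord i.+1 == ord0 = false)//; apply/eqP => /(congr1 val)/=;
    rewrite inordK// ltnS; have := ltn_ord i; lia.
have shift_inj : injective (fun i : 'I_n => inord i.+1 : 'I_n.+2).
  move=> i j /(congr1 val); have := ltn_ord i; have := ltn_ord j.
  by rewrite /= => jn iN; rewrite !inordK; [case=> /val_inj | lia | lia].
have cQ : #|[set B | Q B]| = (count_missing n k * 4)%N.
  rewrite (@card_preimset_inj _ _ _ (fun C => (k <= #|unsummed_set C|)%N) shift_inj).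
  by rewrite (card_ord n.+2) (card_ord n) -(addn2 n) addKn.
have half : (2 * #|[set B : {set 'I_n.+2} | Q B & ord0 \notin B]|)%N = #|[set B | Q B]|.
  by rewrite -card_toggle_mem// -card_toggle.
rewrite /count_missing -(cardsID [set B : {set 'I_n.+2} | ord0 \in B]) addnC.
congr (_ + _)%N; last first.
  by apply: eq_card => B; rewrite !inE andbC.
rewrite -/(count_missing n k).
suff -> : [set B : {set 'I_n.+2} | (k.+2 <= #|unsummed_set B|)%N]
     :\: [set B : {set 'I_n.+2} | ord0 \in B]
   = [set B : {set 'I_n.+2} | Q B & ord0 \notin B] by lia.
apply/setP => B; rewrite !inE andbC; case: (boolP (ord0 \in B)) => B0; rewrite ?andbF ?andbT//.
by rewrite card_unsummed_unshift.
Qed.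

(** * Exponential bounds for the counts *)

Section ProbBound.
Variable R : realType.

Lemma card_sets_with_first_exp : exists K r : R,
  [/\ 0 <= K, 0 <= r, r ^+ 2 < 2^-1 &
   forall n k, #|sets_with_first n k|%:R <= K * r ^+ k * 2 ^+ n.+1].
Proof.
have [phi phiE] : exists phi, phi = 3072%N by exists 3072%N.
have [c cE] : exists c, c = 512%N by exists 512%N.
pose K := 2 ^+ (544 * phi) + 17 : R.
have K_ge0 : 0 <= K by rewrite addr_ge0 ?exprn_ge0.
pose th := 2^-1 ^+ (c + 2) : R.
have th_gt0 : 0 < th by rewrite exprn_gt0.
(* Thus [r = 2^(-514/1024)], just below [2^(-1/2)]. Rounding [k] down to a multiple of 1024 costs at
   most the factor [1/th] in the final constant. *)
pose r := th `^ (2 * c)%:R^-1.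
have c_gt0 : (0 < 2 * c)%N by rewrite cE.
have r_ge0 : 0 <= r by exact: powR_ge0.
have rE : r ^+ (2 * c) = th.
  by rewrite -powR_mulrn// -powRrM mulVf ?powRr1 ?ltW// pnatr_eq0 -lt0n.
have r2 : r ^+ 2 < 2^-1.
  rewrite ltNge; apply/negP => r2.
  have : 2^-1 ^+ c <= th.
    by rewrite -rE exprM; apply: lerXn2r; rewrite ?nnegrE ?exprn_ge0.
  by rewrite /th exprD ler_pMr ?exprn_gt0//; lra.
have r_le1 : r <= 1.
  by rewrite leNgt; apply/negP => r1; move: r2; rewrite ltNge => /negP; apply; nra.
exists (K / th), r; split => //; first by rewrite divr_ge0// ltW.
move=> n k; pose j := (k %/ (2 * c))%N.
have kj : (2 * c * j <= k)%N by rewrite mulnC leq_divM.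
have kj1 : (k <= 2 * c * j.+1)%N by rewrite mulnC ltnW// ltn_ceil.
have := card_sets_with_first n j phiE R; rewrite -/K => Hj.
have {}Hj : #|sets_with_first n (1024 * j)|%:R <= K * th ^+ j * 2 ^+ n.+1 :> R.
  have thj : th ^+ j * 2 ^+ (514 * j) = 1.
    rewrite /th cE exprM -exprMn -exprMn mulVf ?expr1n//.
  rewrite -(@ler_pM2r _ (2 ^+ (514 * j))) ?exprn_gt0//.
  by rewrite mulrAC -(mulrA K) thj mulr1.
have c1024 : (2 * c = 1024)%N by rewrite cE.
apply: (@le_trans _ _ #|sets_with_first n (1024 * j)|%:R).
  rewrite ler_nat; apply/subset_leq_card/fintype.subsetP => B; rewrite !inE => /andP[-> /=].
  by apply: leq_trans; rewrite -c1024.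
apply: (le_trans Hj); rewrite ler_pM2r ?exprn_gt0// -mulrA ler_wpM2l//.
rewrite mulrC ler_pdivlMr// -exprSr -rE -exprM.
by apply: ler_wiXn2l => //.
Qed.

Lemma count_missing_le : exists2 D : R, 0 < D &
  forall n k, (count_missing n k)%:R / 2 ^+ n <= D / Num.sqrt 2 ^+ k.
Proof.
have [K [r [K_ge0 r_ge0 r2 Kr]]] := card_sets_with_first_exp.
pose s : R := Num.sqrt 2.
have s2 : s ^+ 2 = 2 by rewrite sqr_sqrtr.
have s_gt0 : 0 < s by rewrite sqrtr_gt0.
have s_ge1 : 1 <= s by rewrite -[leLHS]sqrtr1 ler_wsqrtr// ler1n.
pose h := s^-1.
have h_gt0 : 0 < h by rewrite invr_gt0.
have h2 : h ^+ 2 = 2^-1 by rewrite exprVn s2.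
have rh : r <= h.
  by rewrite leNgt; apply/negP => hr; move: r2; rewrite ltNge => /negP; apply; nra.
have h_le1 : h <= 1 by rewrite invf_le1.
(* [E] solves [K r^(k+2) - E r^k / 2 = - E r^(k+2)], so the bound [D h^k - E r^k] reproduces itself
   under the recursion. *)
pose E := K * r ^+ 2 / (2^-1 - r ^+ 2).
have d_gt0 : 0 < 2^-1 - r ^+ 2 by rewrite subr_gt0.
have E_ge0 : 0 <= E by rewrite divr_ge0 ?mulr_ge0 ?exprn_ge0// ltW.
have EE : E * (2^-1 - r ^+ 2) = K * r ^+ 2 by rewrite divfK ?gt_eqF.
(* Large enough for both base cases: [D - E] and [D h - E r] are at least 1. *)
pose D := s * (1 + E).
have Dh : D * h = 1 + E by rewrite mulrAC mulfV ?mul1r ?gt_eqF.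
have D1E : 1 + E <= D by rewrite ler_peMl ?addr_ge0.
have count_le n k : (count_missing n k)%:R <= 2 ^+ n :> R.
  rewrite -natrX ler_nat -[X in (2 ^ X)%N]card_ord -cardsT -card_powerset.
  by apply/subset_leq_card/fintype.subsetP => B _; rewrite powersetE finset.subsetT.
(* The correction term [E * r ^+ k] absorbs the error term of the recursion. *)
suff main k : forall n, (count_missing n k)%:R / 2 ^+ n <= D * h ^+ k - E * r ^+ k
                     /\ (count_missing n k.+1)%:R / 2 ^+ n <= D * h ^+ k.+1 - E * r ^+ k.+1.
  exists D => [|n k]; first by rewrite mulr_gt0// ltr_pwDl.
  rewrite -(exprVn (Num.sqrt 2)) -/h; have [Hk _] := main k n; apply: (le_trans Hk).
  by rewrite gerBl mulr_ge0// exprn_ge0.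
elim: k => [|k IH] n.
  rewrite !expr0 !expr1 !mulr1 Dh.
  have xle1 l : (count_missing n l)%:R / 2 ^+ n <= 1 :> R.
    by rewrite ler_pdivrMr ?exprn_gt0// mul1r.
  split; first by apply: le_trans (xle1 _) _; lra.
  apply: le_trans (xle1 _) _; nra.
split; first by case: (IH n).
have small : (n < k.+2)%N -> (count_missing n k.+2)%:R / 2 ^+ n <= D * h ^+ k.+2 - E * r ^+ k.+2.
  move=> nk; have -> : count_missing n k.+2 = 0%N.
    apply/eqP; rewrite cards_eq0; apply/eqP/setP => B; rewrite !inE; apply/negbTE.
    by rewrite -ltnNge; apply: leq_ltn_trans nk; rewrite -[X in (_ <= X)%N]card_ord max_card.
  rewrite mul0r subr_ge0; apply: ler_pM; rewrite ?exprn_ge0//; first lra.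
  by apply: lerXn2r; rewrite ?nnegrE// ltW.
case: n small => [|[|n]] small; [exact: small | exact: small | clear small].
have [IHk _] := IH n.
rewrite count_missing_rec natrD natrM mulrDl.
have -> : 2 * (count_missing n k)%:R / 2 ^+ n.+2 = 2^-1 * ((count_missing n k)%:R / 2 ^+ n) :> R.
  by rewrite !exprS; field; rewrite expf_neq0.
have yle : #|sets_with_first n.+1 k.+2|%:R / 2 ^+ n.+2 <= K * r ^+ k.+2.
  by rewrite ler_pdivrMr ?exprn_gt0.
have -> : h ^+ k.+2 = 2^-1 * h ^+ k by rewrite -addn2 exprD h2 mulrC.
apply: (@le_trans _ _ (2^-1 * (D * h ^+ k - E * r ^+ k) + K * r ^+ k.+2)).
  by apply: lerD => //; rewrite ler_pM2l.
suff -> : K * r ^+ k.+2 = r ^+ k * (E * (2^-1 - r ^+ 2)).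
  rewrite -(addn2 k) exprD; lra.
by rewrite EE -(addn2 k) exprD; ring.
Qed.

End ProbBound.

(** * From counting to probability *)

Import numFieldNormedType.Exports.
Local Open Scope classical_set_scope.
Local Open Scope ring_scope.

Definition trace n (S : set nat) : {set 'I_n} := [set i : 'I_n | `[< S i.+1 >]]%SET.

(** Summands of [t.+1] are positive, hence at most [t < n], so the trace sees all of them. *)
Lemma unsummed_trace n (S : set nat) (t : 'I_n) : S `<=` posnat ->
  unsummed (trace n S) t <-> missing_sums S t.+1.
Proof.
move=> Spos; split => [/unsummedP H|[_ H]].
  split => // -[a Sa [b Sb ab]]; have := Spos _ Sa; have := Spos _ Sb.
  rewrite /posnat/= => b0 a0; have := ltn_ord t => tn.
  have an : (a.-1 < n)%N by lia.
  have bn : (b.-1 < n)%N by lia.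
  apply: (H (Ordinal an) (Ordinal bn)); rewrite ?inE /= ?prednK//.
  lia.
apply/unsummedP => i j; rewrite !inE => Si Sj ijt.
apply: H; apply: (ex_intro2 _ _ i.+1 Si); apply: (ex_intro2 _ _ j.+1 Sj).
by rewrite addSn addnS ijt.
Qed.

Lemma card_le_missing (S : set nat) k : S `<=` posnat ->
  (`I_k #<= missing_sums S)%card <->
  exists n, (k <= #|unsummed_set (trace n S)|)%N.
Proof.
move=> Spos; split.
  (* The sum of the [k] missing numbers is a convenient upper bound for each of them. *)
  move=> /pcard_leP[f]; pose n := (\sum_(i < k) f i)%N.
  have fS (i : 'I_k) : missing_sums S (f i) by apply: funS => /=; exact: ltn_ord.
  have fn (i : 'I_k) : (0 < f i <= n)%N.
    by have [+ _] := fS i; rewrite /posnat /= => ->; rewrite /n (bigD1 i)//= leq_addr.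
  have f'n (i : 'I_k) : ((f i).-1 < n)%N by have := fn i; lia.
  pose g (i : 'I_k) : 'I_n := Ordinal (f'n i).
  have g_inj : injective g.
    move=> i j /(congr1 val)/= gij; apply: val_inj; apply: (@inj _ _ _ f); rewrite ?inE//=.
    have /andP[fi _] := fn i; have /andP[fj _] := fn j.
    by rewrite -(prednK fi) gij prednK.
  exists n; rewrite -[X in (X <= _)%N]card_ord -(card_imset _ g_inj).
  apply/subset_leq_card/fintype.subsetP => _ /imsetP[i _ ->].
  rewrite inE; apply/(unsummed_trace _ Spos); rewrite /= prednK//.
  by have /andP[] := fn i.
move=> [n kn]; pose E := enum (unsummed_set (trace n S)).
pose f i := nth 0%N [seq (val t).+1 | t : 'I_n <- E] i.
have sE : size [seq (val t).+1 | t : 'I_n <- E] = #|unsummed_set (trace n S)|.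
  by rewrite size_map -cardE.
have finj : {in `I_k &, injective f}.
  move=> i j; rewrite !inE /= => ik jk /eqP.
  rewrite /f nth_uniq ?sE ?(leq_trans _ kn)//; first by move=> /eqP.
  rewrite map_inj_uniq ?enum_uniq// => x y [] /val_inj; exact.
rewrite -(card_le_eql (inj_card_eq finj)); apply: subset_card_le => _ [i ik <-].
have : f i \in [seq (val t).+1 | t : 'I_n <- E] by apply: mem_nth; rewrite sE (leq_trans _ kn).
by move=> /mapP[t]; rewrite mem_enum inE => tE ->; exact/unsummed_trace.
Qed.

Section Transfer.
Variables (R : realType) (d : measure_display) (T : measurableType d)
  (P : probability T R) (A : T -> set nat).
Hypothesis hA : uniform_random_subset P A.

Definition cylinder (s1 s2 : seq nat) : set T :=
  [set w | (forall i, i \in s1 -> A w i) /\ (forall i, i \in s2 -> ~ A w i)].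

(** Induction on the excluded elements: excluding [x] subtracts the cylinder where [x] is included,
    which has half the probability. Without exclusions this is mutual independence. *)
Lemma cylinder_probability s1 s2 : uniq (s1 ++ s2) -> (forall i, i \in s1 ++ s2 -> posnat i) ->
  measurable (cylinder s1 s2) /\ P (cylinder s1 s2) = (2^-1 ^+ (size s1 + size s2))%:E.
Proof.
elim: s2 s1 => [|x s2 IH] s1 us ps.
  rewrite cats0 in us ps.
  have cE : cylinder s1 [::] = \bigcap_(i in [set` [fset i in s1]%fset]) [set w | A w i].
    apply/seteqP; split => w /= => [[H _] i|H]; first by rewrite /= in_fset => /H.
    by split => // i is1; apply: H; rewrite /= in_fset.
  have sub : [set` [fset i in s1]%fset] `<=` posnat by move=> i; rewrite /= in_fset => /ps.
  split.
    rewrite cE; apply: bigcap_measurableType => i /sub; exact: (random_subset_measurable hA).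
  rewrite cE (random_subset_independent hA)//.
  rewrite (eq_big_seq (fun=> (2^-1 : R)%:E)); last first.
    by move=> i; rewrite in_fset => /ps; exact: (random_subset_half hA).
  rewrite prodEFin big_const_seq count_predT addn0; congr (_%:E).
  by rewrite -[in RHS](undup_id us) -(card_fseq s1) iter_mulr_1.
have usx : uniq ((x :: s1) ++ s2) by move: us; rewrite -cat1s uniq_catCA.
have usy : uniq (s1 ++ s2) by move: usx => /= /andP[].
have [||m1 P1] := IH (x :: s1) => //.
  by move=> i; rewrite /= inE mem_cat => H; apply: ps; rewrite mem_cat inE orbCA.
have [||m2 P2] := IH s1 => //.
  by move=> i; rewrite mem_cat => H; apply: ps; rewrite mem_cat inE orbCA H orbT.
have cE : cylinder s1 (x :: s2) = cylinder s1 s2 `\` cylinder (x :: s1) s2.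
  apply/seteqP; split => w /=.
    move=> [H1 H2]; split; first by split => // i is2; apply: H2; rewrite inE is2 orbT.
    by move=> [H3 _]; apply: (H2 x); [rewrite mem_head | apply: H3; rewrite mem_head].
  move=> [[H1 H2] H3]; split => // i; rewrite inE => /orP[/eqP-> Ax|/H2//].
  by apply: H3; split => // j; rewrite inE => /orP[/eqP->//|/H1].
have cI : cylinder s1 s2 `&` cylinder (x :: s1) s2 = cylinder (x :: s1) s2.
  apply/setIidr => w [H1 H2]; split => // i is1; apply: H1; by rewrite inE is1 orbT.
split; first by rewrite cE; exact: measurableD.
have PD : P (cylinder s1 s2 `\` cylinder (x :: s1) s2)
    = (P (cylinder s1 s2) - P (cylinder (x :: s1) s2))%E.
  rewrite -[in RHS]cI; apply: measureD => //.
  by apply: (le_lt_trans (probability_le1 P m2)); rewrite ltry.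
rewrite cE PD P1 P2 -EFinB; congr (_%:E).
by rewrite /= addSn addnS exprS; lra.
Qed.

Lemma trace_probability n (B : {set 'I_n}) :
  measurable [set w | trace n (A w) = B] /\ P [set w | trace n (A w) = B] = (2^-1 ^+ n)%:E.
Proof.
pose code (C : {set 'I_n}) := [seq (val i).+1 | i <- enum C].
have codeP (C : {set 'I_n}) (i : 'I_n) : (i.+1 \in code C) = (i \in C).
  by rewrite -(mem_enum (mem C)) (mem_map (f := fun i : 'I_n => (val i).+1))// => x y [] /val_inj.
have cE : [set w | trace n (A w) = B] = cylinder (code B) (code (~: B)%SET).
  apply/seteqP; split => w /=.
    move=> <-; split => _ /mapP[i + ->]; rewrite mem_enum !inE => H; first exact: H.
    by move: H => /asboolPn.
  move=> [H1 H2]; apply/setP => i; rewrite inE; apply/asboolP/idP => [Ai|iB].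
    apply: contraPT Ai => iB; apply: H2; by rewrite codeP inE.
  by apply: H1; rewrite codeP.
have sz : (size (code B) + size (code (~: B)%SET) = n)%N.
  by rewrite !size_map -!cardE cardsC card_ord.
rewrite cE -[in X in _ /\ _ = X]sz; apply: cylinder_probability.
  rewrite -map_cat map_inj_uniq; last by move=> x y [] /val_inj.
  rewrite cat_uniq !enum_uniq andbT /=; apply/hasPn => i.
  by rewrite !mem_enum inE.
by move=> i; rewrite mem_cat => /orP[]/mapP[j _ ->].
Qed.

Lemma trace_event_probability n (Q : pred {set 'I_n}) :
  measurable [set w | Q (trace n (A w))] /\
  P [set w | Q (trace n (A w))] = (#|[set B | Q B]%SET|%:R / 2 ^+ n)%:E.
Proof.
suff main (r : seq {set 'I_n}) : uniq r -> measurable [set w | trace n (A w) \in r] /\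
    P [set w | trace n (A w) \in r] = ((size r)%:R / 2 ^+ n)%:E.
  have := main (enum [set B | Q B]%SET) (enum_uniq _); rewrite -cardE.
  suff -> : [set w | trace n (A w) \in enum [set B | Q B]%SET] = [set w | Q (trace n (A w))] by [].
  by apply/seteqP; split => w /=; rewrite mem_enum inE.
elim: r => [_|B r IH /= /andP[Br /IH[mr Pr]]].
  rewrite (_ : mkset _ = set0); last by apply/seteqP; split => w.
  by rewrite measure0 mul0r; split => //; exact: measurable0.
have [mB PB] := trace_probability B.
have -> : [set w | trace n (A w) \in B :: r] =
    [set w | trace n (A w) = B] `|` [set w | trace n (A w) \in r].
  apply/seteqP; split => w /=; rewrite inE; first by move=> /orP[/eqP|]; [left|right].
  by move=> [->|->]; rewrite ?eqxx ?orbT.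
split; first exact: measurableU.
have -> : P ([set w | trace n (A w) = B] `|` [set w | trace n (A w) \in r])
    = (P [set w | trace n (A w) = B] + P [set w | trace n (A w) \in r])%E.
  apply: measureU => //.
  by apply/seteqP; split => // w [/= ->]; rewrite (negbTE Br).
by rewrite PB Pr -EFinD -[(size (B :: r))%:R]natr1 mulrDl mul1r exprVn addrC.
Qed.

Let level k n : set T := [set w | (k <= #|unsummed_set (trace n (A w))|)%N].

(** The events [level k n] increase with [n], and their union is the event of at least [k] missing
    sums; continuity from below applies. *)
Lemma prob_missing_cvg k :
  (fun n => (count_missing n k)%:R / 2 ^+ n) @ \oo --> prob_missing P A k.
Proof.
have Apos := random_subset_posnat hA.
have lE : [set w | (`I_k #<= missing_sums (A w))%card] = \bigcup_n level k n.
  apply/seteqP; split => w /=.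
    by move=> /(card_le_missing _ (Apos w))[n kn]; exists n.
  by move=> [n _ kn]; apply/(card_le_missing _ (Apos w)); exists n.
have mlevel n : measurable (level k n).
  by have [] := trace_event_probability (fun B : {set 'I_n} => (k <= #|unsummed_set B|)%N).
have Plevel n : P (level k n) = ((count_missing n k)%:R / 2 ^+ n)%:E.
  by have [] := trace_event_probability (fun B : {set 'I_n} => (k <= #|unsummed_set B|)%N).
have level_nd : {homo level k : n m / (n <= m)%N >-> (n <= m)%O}.
  move=> n n' nn'; apply/subsetPset => w; rewrite /level /=; move/leq_trans; apply.
  have widen_inj : injective (widen_ord nn') by move=> x y /(congr1 val)/= /val_inj.
  rewrite -(card_imset _ widen_inj); apply/subset_leq_card/fintype.subsetP.
  move=> _ /imsetP[t + ->]; rewrite !inE => /(unsummed_trace _ (Apos w)) H.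
  exact/(unsummed_trace _ (Apos w)).
rewrite /prob_missing lE.
have mU : measurable (\bigcup_n level k n) by exact: bigcupT_measurable.
have : (fun n => P (level k n)) @ \oo --> (fine (P (\bigcup_n level k n)))%:E.
  rewrite fineK; last exact: fin_num_measure.
  exact: nondecreasing_cvg_mu.
move=> /fine_cvg; under eq_fun do rewrite /= Plevel; exact.
Qed.

End Transfer.

(** * Bounds and monotonicity in the limit *)

Section ProbMissing.
Variables (R : realType) (d : measure_display) (T : measurableType d)
  (P : probability T R) (A : T -> set nat).
Hypothesis hA : uniform_random_subset P A.

Let x n k : R := (count_missing n k)%:R / 2 ^+ n.
Let q := prob_missing P A.

Lemma count_missing_succ n k : (count_missing n k.+1 <= count_missing n k)%N.
Proof.
apply/subset_leq_card/fintype.subsetP => B; rewrite !inE; exact: ltnW.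
Qed.

Let x_cvg k : x^~ k @ \oo --> q k := prob_missing_cvg hA (k := k).

Lemma prob_missing_ub M k : (forall n, x n k <= M) -> q k <= M.
Proof.
by move=> xM; apply: ler_cvg_to (@x_cvg k) (cvg_cst M) _; exact: nearW.
Qed.

Lemma prob_missing_succ k : q k.+1 <= q k.
Proof.
apply: ler_cvg_to (@x_cvg k.+1) (@x_cvg k) _; apply: nearW => n.
by rewrite ler_pM2r ?invr_gt0 ?exprn_gt0// ler_nat count_missing_succ.
Qed.

(** Drop the nonnegative term [sets_with_first] from the recursion and let [n] tend to infinity. *)
Lemma prob_missing_shift k : q k / 2 <= q k.+2.
Proof.
have x2 : (fun n => x (n + 2) k.+2) @ \oo --> q k.+2.
  by rewrite (cvg_shiftn 2 (x^~ k.+2)); exact: x_cvg.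
apply: ler_cvg_to (cvgM (@x_cvg k) (cvg_cst (2^-1 : R))) x2 _; apply: nearW => n.
rewrite /x addn2 count_missing_rec natrD natrM.
have e_neq0 : 2 ^+ n != 0 :> R by rewrite expf_neq0.
rewrite ler_pdivlMr ?exprn_gt0// !exprS.
set c := (count_missing n k)%:R.
have -> : c / 2 ^+ n / 2 * (2 * (2 * 2 ^+ n)) = 2 * c by field.
by rewrite lerDl.
Qed.

(** The integer 1 is never a sum. The sequence is shifted by one because this needs a nonempty
    segment. *)
Lemma prob_missing_ge1 k : (k <= 1)%N -> 1 <= q k.
Proof.
move=> k1.
have x1 : (fun n => x (n + 1) k) @ \oo --> q k by rewrite (cvg_shiftn 1 (x^~ k)); exact: x_cvg.
apply: ler_cvg_to (cvg_cst (1 : R)) x1 _; apply: nearW => n.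
rewrite /x addn1 ler_pdivlMr ?exprn_gt0// mul1r -natrX ler_nat.
rewrite -[X in (2 ^ X)%N]card_ord -cardsT -card_powerset.
apply/subset_leq_card/fintype.subsetP => B _; rewrite inE (leq_trans k1)//.
by apply/card_gt0P; exists ord0; rewrite inE; apply/unsummedP.
Qed.

Lemma scaled_probE k : scaled_prob P A k = Num.sqrt 2 ^+ k * q k.
Proof.
rewrite /scaled_prob -/q; congr (_ * _).
by rewrite mulrC powRrM powR12_sqrt// powR_mulrn ?sqrtr_ge0.
Qed.

Lemma scaled_prob_ub : exists2 D : R, 0 < D & forall k, scaled_prob P A k <= D.
Proof.
have [D D0 HD] := count_missing_le R; exists D => // k.
have s0 : 0 < Num.sqrt 2 ^+ k :> R by rewrite exprn_gt0 ?sqrtr_gt0.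
rewrite scaled_probE mulrC -ler_pdivlMr//; apply: prob_missing_ub => n; exact: HD.
Qed.

Lemma scaled_prob_shift k : scaled_prob P A k <= scaled_prob P A k.+2.
Proof.
rewrite !scaled_probE -[k.+2]addn2 exprD sqr_sqrtr// addn2 -mulrA.
rewrite ler_pM2l ?exprn_gt0 ?sqrtr_gt0//.
by have := prob_missing_shift k; lra.
Qed.

Lemma scaled_prob_succ k : scaled_prob P A k.+1 <= scaled_prob P A k * Num.sqrt 2.
Proof.
rewrite !scaled_probE exprSr mulrAC ler_pM2r ?sqrtr_gt0//.
by rewrite ler_pM2l ?exprn_gt0 ?sqrtr_gt0// prob_missing_succ.
Qed.

(** True for [k = 0] and [k = 1], then propagated in steps of two by monotonicity. *)
Lemma scaled_prob_ge1 k : 1 <= scaled_prob P A k.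
Proof.
suff : 1 <= scaled_prob P A k /\ 1 <= scaled_prob P A k.+1 by case.
elim: k => [|k [IH IH']].
  have s_ge1 : 1 <= Num.sqrt 2 :> R by rewrite -[leLHS]sqrtr1 ler_wsqrtr// ler1n.
  by rewrite !scaled_probE expr0 expr1 !mulr_ege1 ?prob_missing_ge1.
by split => //; apply: le_trans (scaled_prob_shift k).
Qed.

Lemma prob_missing_order : same_order (prob_missing P A) (fun k => 2 `^ (- (k%:R / 2))).
Proof.
have [D D0 HD] := scaled_prob_ub; exists 1, D; split => // k.
have w0 : 0 < 2 `^ (k%:R / 2) :> R by rewrite powR_gt0.
rewrite powRN mul1r ler_pdivlMr// -[X in X <= _ <= _]div1r ler_pdivrMr//.
by rewrite mulrC scaled_prob_ge1 HD.
Qed.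

End ProbMissing.

Unset Implicit Arguments.

Theorem theorem1p2 (R : realType) (d : measure_display)
    (T : measurableType d) (P : probability T R) (A : T -> set nat)
    (hA : uniform_random_subset P A) :
  let p : nat -> R := scaled_prob P A in
  let p_even : nat -> R := fun k => p (2 * k)%N in
  let p_odd : nat -> R := fun k => p (2 * k + 1)%N in
  [/\ nondecreasing_seq p_even /\ nondecreasing_seq p_odd,
      bounded_fun p_even /\ bounded_fun p_odd,
      cvgn p_even /\ cvgn p_odd,
      same_order (prob_missing P A) (fun k => 2 `^ (- (k%:R / 2))) &
      exists c : R, [/\ 0 < c,
        c <= limn p_even <= c * Num.sqrt 2 &
        c <= limn p_odd <= c * Num.sqrt 2]].
Proof.
move=> p p_even p_odd.
have [D D_gt0 pD] := scaled_prob_ub hA.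
have p_ge1 := scaled_prob_ge1 hA.
have p_succ := scaled_prob_succ hA.
have evenS : nondecreasing_seq p_even.
  by apply/nondecreasing_seqP => k; rewrite /p_even mulnS add2n; exact: scaled_prob_shift.
have oddS : nondecreasing_seq p_odd.
  by apply/nondecreasing_seqP => k; rewrite /p_odd mulnS add2n addSn addSn;
    exact: scaled_prob_shift.
have bounded (f : nat -> nat) : bounded_fun (fun k => p (f k)).
  exists D; split => [|M DM k _]; first exact: num_real.
  by rewrite /= ger0_norm ?(le_trans _ (p_ge1 _))// (le_trans (pD _) (ltW DM)).
have cvg_even : cvgn p_even.
  by apply: nondecreasing_is_cvgn => //; exists D => _ [k _ <-]; exact: pD.
have cvg_odd : cvgn p_odd.
  by apply: nondecreasing_is_cvgn => //; exists D => _ [k _ <-]; exact: pD.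
have even_le := nondecreasing_cvgn_le evenS cvg_even.
have odd_le := nondecreasing_cvgn_le oddS cvg_odd.
have s_ge0 : 0 <= Num.sqrt 2 :> R by exact: sqrtr_ge0.
have s_ge1 : 1 <= Num.sqrt 2 :> R by rewrite -[leLHS]sqrtr1 ler_wsqrtr// ler1n.
(* Since [2 (k + 1)] follows [2 k + 1], first move from [p_even k] up to [p_even k.+1]. *)
have le_eo : limn p_even <= limn p_odd * Num.sqrt 2.
  apply: limr_le => //; near=> k.
  apply: (@le_trans _ _ (p_odd k * Num.sqrt 2)); last by rewrite ler_wpM2r.
  apply: (le_trans (evenS _ _ (leqnSn k))).
  by rewrite /p_even /p_odd mulnS add2n addn1; exact: p_succ.
have le_oe : limn p_odd <= limn p_even * Num.sqrt 2.
  apply: limr_le => //; near=> k.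
  apply: (@le_trans _ _ (p_even k * Num.sqrt 2)); last by rewrite ler_wpM2r.
  by rewrite /p_even /p_odd addn1; exact: p_succ.
have even_ge1 : 1 <= limn p_even by exact: le_trans (p_ge1 _) (even_le 0).
have odd_ge1 : 1 <= limn p_odd by exact: le_trans (p_ge1 _) (odd_le 0).
split => //; [by split; exact: bounded | exact: prob_missing_order |].
(* Each limit is at most [Num.sqrt 2] times the other, so the smaller one serves as [c]. *)
exists (Num.min (limn p_even) (limn p_odd)); split.
- by rewrite lt_min !(lt_le_trans ltr01).
- by rewrite ge_min lexx /=; case: (leP (limn p_even) (limn p_odd)) => _ //;
    rewrite ler_peMr// (le_trans ler01).
- by rewrite ge_min lexx orbT /=; case: (leP (limn p_even) (limn p_odd)) => _ //;
    rewrite ler_peMr// (le_trans ler01).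
Unshelve. all: by end_near.
Qed.
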